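(* For every graph $G$, \[\mathrm{ME}(G)\geq 4\operatorname{av}(G).\]
   Context: A matching of a graph is a set of pairwise vertex-disjoint edges; $m(G,k)$ denotes the number of matchings of cardinality $k$ in $G$, and $\operatorname{av}(G)=\frac{\sum_{k\ge0}k\,m(G,k)}{\sum_{k\ge0}m(G,k)}$ is the average size of a matching of $G$. For an $n$-vertex graph $G$, the matching polynomial is $\Phi(G,x)=\sum_{k\geq 0}m(G,k)(-1)^k x^{n-2k}$, with (real) zeros $\mu_1,\dots,\mu_n$, and the matching energy is $\mathrm{ME}(G)=\sum_{j=1}^n|\mu_j|$. *)

(* Defs.v *)
From mathcomp Require Import all_boot all_order all_algebra.
From mathcomp Require Import complex reals.

Set Implicit Arguments.
Unset Strict Implicit.
Unset Printing Implicit Defensive.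

Import Order.TTheory GRing.Theory Num.Theory.
Local Open Scope ring_scope.

Record sgraph := SGraph {
  vertex : finType;
  adj : rel vertex;
  adj_sym : symmetric adj;
  adj_irrefl : irreflexive adj
}.

Definition order_of (G : sgraph) : nat := #|vertex G|.

Definition edges (G : sgraph) : {set {set vertex G}} :=
  [set [set p.1; p.2] | p : vertex G * vertex G & adj p.1 p.2].

Definition is_matching (G : sgraph) (M : {set {set vertex G}}) : bool :=
  (M \subset edges G) && trivIset M.

Definition nmatch (G : sgraph) (k : nat) : nat :=
  #|[set M : {set {set vertex G}} | is_matching M & #|M| == k]|.

(* The sums over all k >= 0 below are cut at k <= n / 2, which loses nothing:
   [nmatch G k] vanishes beyond.  The same bound makes the truncated
   subtraction in the exponent n - 2k exact. *)
Lemma nmatch_eq0 (G : sgraph) (k : nat) :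
  ((order_of G)./2 < k)%N -> nmatch G k = 0%N.
Proof.
move=> lt_k; apply/eqP; rewrite cards_eq0 -subset0; apply/subsetP => M.
rewrite !inE => /andP[/andP[/subsetP sME /eqP tM] /eqP cM].
have sumM : (\sum_(B in M) #|B| = k.*2)%N.
  rewrite -cM -muln2 -sum_nat_const; apply: eq_bigr => B /sME.
  move=> /imsetP[[x y]]; rewrite inE /= => xy ->; rewrite cards2.
  by case: eqP xy => // ->; rewrite adj_irrefl.
by move: lt_k; rewrite ltn_half_double ltnNge -sumM tM max_card.
Qed.

Definition av (R : realType) (G : sgraph) : R :=
  (\sum_(k < (order_of G)./2.+1) k%:R * (nmatch G k)%:R)
  / (\sum_(k < (order_of G)./2.+1) (nmatch G k)%:R).

Definition matching_poly (A : nzRingType) (G : sgraph) : {poly A} :=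
  \sum_(k < (order_of G)./2.+1)
    ((nmatch G k)%:R * (-1) ^+ k) *: 'X^(order_of G - k.*2).

(* All complex zeros, listed with multiplicity: [closed_field_poly_normal p]
   yields s with p = lead_coef p *: \prod_(z <- s) ('X - z%:P).  That they are
   real is a theorem, not built into the definition, and is not needed for the
   absolute values in the matching energy to make sense. *)
Definition matching_zeros (R : realType) (G : sgraph) : seq R[i] :=
  sval (closed_field_poly_normal (matching_poly R[i] G)).

Definition matching_energy (R : realType) (G : sgraph) : R :=
  \sum_(mu <- matching_zeros R G) ComplexField.Normc.normc mu.

(* Main.v *)
Require Import Defs.
From mathcomp Require Import all_boot all_order all_algebra.
From mathcomp Require Import complex reals.
From mathcomp Require Import ring lra zify.

(* Heilmann and Lieb: the zeros mu of the matching polynomial Phi are real,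
   because the vertex recurrence keeps Phi(G, z) / Phi(G - v, z) in the open
   half-plane of a non-real z.  Evaluating the logarithmic derivative of Phi
   at the imaginary unit, where all matchings count with the same sign, gives
   n - 2 av(G) = sum_mu 1 / (1 + mu^2), that is,
   2 av(G) = sum_mu mu^2 / (1 + mu^2), and mu^2 / (1 + mu^2) <= |mu| / 2. *)

Set Implicit Arguments.
Unset Strict Implicit.
Unset Printing Implicit Defensive.

Import Order.TTheory GRing.Theory Num.Theory.
Local Open Scope ring_scope.

(** * Vertex recurrence for the matching generating function *)

Section MatchingGF.

Variables (A : nzRingType) (G : sgraph) (w : A).
Implicit Types (S e : {set vertex G}) (M : {set {set vertex G}}).
Implicit Types (u v : vertex G).

(** Induced subgraphs are encoded as vertex sets [S] of one fixed graph, so deleting a vertex is a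
    set difference. At [w = - z ^- 2] this is Phi(G[S], z) / z^|S|. *)
Definition matching_gf S : A :=
  \sum_(M : {set {set vertex G}} | is_matching M && (cover M \subset S))
    w ^+ #|M|.

Lemma edge_neighborP v e :
  e \in edges G -> v \in e -> exists2 u, adj v u & e = [set v; u].
Proof.
case/imsetP=> -[x y]; rewrite inE /= => xy ->.
rewrite !inE => /orP[] /eqP ->; first by exists y.
by exists x; rewrite 1?adj_sym // setUC.
Qed.

Lemma in_edges v u : adj v u -> [set v; u] \in edges G.
Proof. by move=> vu; apply/imsetP; exists (v, u); rewrite ?inE. Qed.

Lemma set2_injr v u u' : [set v; u] = [set v; u'] -> u = u'.
Proof.
move=> E; have := set22 v u; have := set22 v u'.
by rewrite E -{1}E !inE => /orP[/eqP ->|/eqP ->] // /orP[] /eqP.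
Qed.

Lemma cover_set1U e M : cover (e |: M) = e :|: cover M.
Proof.
apply/setP=> x; rewrite inE; apply/bigcupP/orP => [[B]|].
  rewrite !inE => /orP[/eqP ->|BM xB]; first by left.
  by right; apply/bigcupP; exists B.
case=> [xe|/bigcupP[B BM xB]]; first by exists e; rewrite ?setU11.
by exists B; rewrite // setU1r.
Qed.

(** This makes M |-> e |: M a bijection from the matchings inside [S :\: e] onto the matchings
    inside [S] that contain [e]; the clause [e \notin M] gives injectivity. *)
Lemma is_matching_set1U e M S : e \in edges G -> e \subset S ->
  [&& is_matching (e |: M), cover (e |: M) \subset S & e \notin M]
  = is_matching M && (cover M \subset S :\: e).
Proof.
move=> eE eS; rewrite cover_set1U subUset eS subsetD.
apply/and3P/and3P => [[/andP[sM tM] cS eM]|[/andP[sM tM] cS /pred0P dM]].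
  split=> //.
    rewrite /is_matching (subset_trans (subsetUr _ _) sM).
    exact: trivIsetS (subsetUr _ _) tM.
  rewrite disjoint_sym disjoint_subset; apply/subsetP => x xe; rewrite inE.
  apply/negP => /bigcupP[B BM xB].
  have /trivIsetP/(_ e B (setU11 _ _) (setU1r _ BM)) := tM.
  case: eqVneq => [E _|_ /(_ isT) /disjointFr /(_ xe)]; last by rewrite xB.
  by rewrite E BM in eM.
have dis B : B \in M -> [disjoint e & B].
  move=> BM; rewrite disjoint_subset; apply/subsetP => x xe; rewrite inE.
  apply: contraFN (dM x) => xB; rewrite /= xe andbT.
  by apply/bigcupP; exists B.
(* Edges are nonempty, so [e], disjoint from every member of [M], cannot itself belong to [M]. *)
have M0 : set0 \notin M.
  apply: contraL sM => M0; apply/subsetPn; exists set0 => //.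
  apply/negP => /imsetP[[x y] _] /esym/eqP; rewrite -subset0 => /subsetP/(_ x).
  by rewrite !inE eqxx => /(_ isT).
have [tU eM] := trivIsetU1 dis tM M0.
by split=> //; rewrite /is_matching tU subUset sub1set eE sM.
Qed.

(** Either a matching misses [v], or it contains exactly one edge [[set v; u]], whose removal leaves
    a matching avoiding both ends and one factor [w]. *)
Lemma matching_gf_rec S v : v \in S ->
  matching_gf S = matching_gf (S :\ v)
    + w * \sum_(u | (u \in S) && adj v u) matching_gf (S :\ v :\ u).
Proof.
move=> vS; rewrite /matching_gf (bigID (fun M => v \notin cover M)) /=.
congr (_ + _).
  by apply: eq_bigl => M; rewrite subsetD1 andbA.
(* The inserted inner sum has a single term: the partner [u] of [v] in [M]. *)
transitivity (\sum_(M : {set {set vertex G}}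
    | (is_matching M && (cover M \subset S)) && ~~ (v \notin cover M))
    \sum_(u | (u \in S) && adj v u && ([set v; u] \in M)) w ^+ #|M|).
  apply: eq_bigr => M /andP[/andP[/andP[sM /trivIsetP tM] cS]].
  rewrite negbK => /bigcupP[e eM ve].
  have [u vu Ee] := edge_neighborP (subsetP sM _ eM) ve.
  rewrite (big_pred1 u) // => u' /=.
  apply/idP/eqP => [/andP[_ u'M]|->].
    have := tM _ _ eM u'M; case: eqVneq => [|_ /(_ isT)/disjointFr/(_ ve)].
      by rewrite Ee => /set2_injr ->.
    by rewrite set21.
  rewrite -Ee eM vu !andbT; apply: (subsetP cS); apply/bigcupP; exists e => //.
  by rewrite Ee set22.
rewrite (exchange_big_dep (fun u => (u \in S) && adj v u)) /=;
  last by move=> M u _ /andP[].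
rewrite big_distrr /=; apply: eq_bigr => u /andP[uS vu].
set e := [set v; u].
have eE : e \in edges G := in_edges vu.
have eS : e \subset S by rewrite subUset !sub1set vS.
have -> : S :\ v :\ u = S :\: e by rewrite /e setDDl.
rewrite (reindex_onto (fun M => e |: M) (fun M => M :\ e)) /=; last first.
  by move=> M /andP[_ /andP[_ eM]]; rewrite setD1K.
rewrite big_distrr /=.
have E M :
    [&& (is_matching (e |: M) && (cover (e |: M) \subset S))
          && ~~ (v \notin cover (e |: M)),
        (u \in S) && adj v u && (e \in e |: M)
      & (e |: M) :\ e == M]
    = is_matching M && (cover M \subset S :\: e).
  rewrite -(is_matching_set1U _ eE eS) -!andbA; congr [&& _, _ & _].
  rewrite uS vu setU11 cover_set1U negbK inE set21 /=.
  congr (_ && _); apply/idP/idP => [/eqP <-|eM]; first by rewrite !inE eqxx.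
  by rewrite setU1K // eqxx.
apply: eq_big => [M|M]; first by rewrite -E -!andbA.
rewrite -andbA E -(is_matching_set1U _ eE eS) => /and3P[_ _ eM].
by rewrite cardsU1 eM exprS.
Qed.

Lemma matching_gf_setT :
  matching_gf setT = \sum_(k < (order_of G)./2.+1) (nmatch G k)%:R * w ^+ k.
Proof.
have ltM M : is_matching M -> (#|M| < (order_of G)./2.+1)%N.
  move=> mM; rewrite ltnS leqNgt; apply/negP => /nmatch_eq0/eqP.
  by rewrite cards_eq0 => /eqP/setP/(_ M); rewrite !inE mM eqxx.
rewrite /matching_gf.
pose size_of M : 'I_(order_of G)./2.+1 := inord #|M|.
rewrite (partition_big size_of predT) //=.
apply: eq_bigr => k _; rewrite mulr_natl -sumr_const.
apply: congr_big => // [M|M].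
  rewrite !inE subsetT andbT /size_of; case mM: (is_matching M) => //=.
  by rewrite -val_eqE /= inordK ?ltM.
by move=> /andP[/andP[mM _] /eqP <-]; rewrite /size_of inordK ?ltM.
Qed.

End MatchingGF.

Lemma is_matching0 (G : sgraph) : is_matching (set0 : {set {set vertex G}}).
Proof. by rewrite /is_matching sub0set; apply/trivIsetP => B; rewrite inE. Qed.

(** * Reality of the zeros *)

Section RealZeros.

Variable R : rcfType.
Local Notation C := R[i].
Implicit Types x y z : C.

Lemma ImD x y : complex.Im (x + y) = complex.Im x + complex.Im y.
Proof. by case: x y => [a b] [c d]. Qed.

Lemma ReD x y : complex.Re (x + y) = complex.Re x + complex.Re y.
Proof. by case: x y => [a b] [c d]. Qed.

(** Im(-1/x) = Im x / |x|^2. The sign of [b] selects the upper or the lower half-plane, so both are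
    treated at once. *)
Lemma Im_opp_inv_gt0 (b : R) x :
  0 < b * complex.Im x -> 0 < b * complex.Im (- x^-1).
Proof.
case: x => c d /= bd; rewrite opprK mulrA divr_gt0 //.
rewrite lt0r addr_ge0 ?sqr_ge0 // andbT paddr_eq0 ?sqr_ge0 // !sqrf_eq0.
by apply: contraTN bd => /andP[_ /eqP ->]; rewrite mulr0 ltxx.
Qed.

Lemma matching_gf0 (A : nzRingType) (G : sgraph) (w : A) :
  matching_gf w (set0 : {set vertex G}) = 1.
Proof.
rewrite /matching_gf (big_pred1 set0) ?cards0 // => M /=.
apply/idP/eqP => [/andP[/andP[/subsetP sM _] cM]|->]; last first.
  by rewrite is_matching0 /cover big_set0 sub0set.
apply/eqP; rewrite -subset0; apply/subsetP => e eM.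
have /imsetP[[x y] _ Ee] := sM e eM.
suff : x \in cover M by move/(subsetP cM); rewrite inE.
by apply/bigcupP; exists e => //; rewrite Ee set21.
Qed.

(* With w = - z^-2 the ratio below is Phi(G[S], z) / Phi(G[S - v], z), and the
   recurrence expresses it as z minus a sum of inverses of smaller ratios; the
   open half-plane containing z is stable under x |-> - x^-1 and sums. *)
Lemma matching_gf_half_plane (G : sgraph) (z : C) (S : {set vertex G}) :
  complex.Im z != 0 ->
  let gf := matching_gf (- z ^- 2) in
  gf S != 0 /\
  forall v, v \in S ->
    0 < complex.Im z * complex.Im (z * gf S / gf (S :\ v)).
Proof.
move=> z0 gf; have [n] := ubnP #|S|; elim: n S => // n IH S ltS.
have nz : z != 0 by apply: contra z0 => /eqP ->.
have ratio v : v \in S ->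
    0 < complex.Im z * complex.Im (z * gf S / gf (S :\ v)).
  move=> vS; have ltSv : (#|S :\ v| < n)%N by rewrite (cardsD1 v S) vS in ltS.
  have [g0 IHv] := IH _ ltSv.
  have -> : z * gf S / gf (S :\ v) =
      z + \sum_(u | (u \in S) && adj v u)
            - (z * gf (S :\ v) / gf (S :\ v :\ u))^-1.
    rewrite {1}/gf (matching_gf_rec _ vS) -/gf mulrDr mulrDl mulfK //.
    congr (_ + _); rewrite !mulrA mulr_sumr mulr_suml; apply: eq_bigr => u _.
    by rewrite invf_div; field; rewrite g0.
  rewrite ImD mulrDr (big_morph _ ImD (erefl : complex.Im (0 : C) = 0)).
  (* The summand z contributes (Im z)^2 > 0; the others need only be nonnegative. *)
  rewrite ltr_pwDl // ?lt0r ?mulf_neq0 -?expr2 ?sqr_ge0 //.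
  rewrite mulr_sumr; apply: sumr_ge0 => u /andP[uS vu].
  apply/ltW/Im_opp_inv_gt0/IHv; rewrite !inE uS andbT.
  by apply: contraTneq vu => ->; rewrite adj_irrefl.
(* A zero of [gf S] would make the ratio at any [v] in [S] vanish, contradicting its strict
   positivity. *)
split=> //; have [->|/set0Pn[v vS]] := eqVneq S set0.
  by rewrite /gf matching_gf0 oner_eq0.
apply: contraTneq (ratio v vS) => ->.
by rewrite mulr0 mul0r /= mulr0 ltxx.
Qed.

Lemma horner_matching_poly (G : sgraph) (z : C) : z != 0 ->
  (matching_poly C G).[z]
  = z ^+ order_of G * matching_gf (- z ^- 2) (setT : {set vertex G}).
Proof.
move=> nz; rewrite matching_gf_setT horner_sum mulr_sumr.
apply: eq_bigr => k _; rewrite hornerZ hornerXn.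
have le2k : (k.*2 <= order_of G)%N.
  by rewrite -geq_half_double -ltnS.
have -> : z ^+ order_of G = z ^+ (order_of G - k.*2) * (z ^+ 2) ^+ k.
  by rewrite -exprM mul2n -exprD subnK.
rewrite [(- z ^- 2) ^+ k]exprNn exprVn; field.
by rewrite !expf_neq0.
Qed.

Lemma root_matching_poly_real (G : sgraph) (z : C) :
  root (matching_poly C G) z -> complex.Im z = 0.
Proof.
apply: contraTeq => z0; rewrite rootE.
have nz : z != 0 by apply: contra z0 => /eqP ->.
rewrite horner_matching_poly // mulf_neq0 ?expf_neq0 //.
by have [] := matching_gf_half_plane (setT : {set vertex G}) z0.
Qed.

End RealZeros.

(** * Degree, and the logarithmic derivative at i *)

Lemma nmatch0 (G : sgraph) : nmatch G 0 = 1%N.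
Proof.
rewrite /nmatch -[RHS](cards1 (set0 : {set {set vertex G}})).
congr #|pred_of_set _|.
apply/setP => M; rewrite !inE cards_eq0 andbC; case: eqP => //= ->.
by rewrite is_matching0.
Qed.

Lemma size_matching_poly (A : nzRingType) (G : sgraph) :
  size (matching_poly A G) = (order_of G).+1.
Proof.
apply/eqP; rewrite eqn_leq; apply/andP; split.
  apply: leq_trans (size_sum _ _ _) _; apply/bigmax_leqP => k _.
  by apply: leq_trans (size_scale_leq _ _) _; rewrite size_polyXn ltnS leq_subr.
suff p1 : (matching_poly A G)`_(order_of G) = 1.
  rewrite ltnNge; apply/negP => /leq_sizeP/(_ _ (leqnn _))/eqP.
  by rewrite p1 oner_eq0.
rewrite coef_sum big_ord_recl /= big1 => [|k _].
  by rewrite nmatch0 coefZ subn0 coefXn eqxx expr0 !mulr1 addr0.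
rewrite coefZ coefXn; case: eqP; last by rewrite mulr0.
(* An index k >= 1 with k <= n/2 forces n >= 2, so the truncated n - 2k is strictly below n. *)
have := ltn_ord k; rewrite /bump /=; lia.
Qed.

Lemma logderiv_prod_XsubC (F : fieldType) (s : seq F) (x : F) : x \notin s ->
  (\prod_(z <- s) ('X - z%:P))^`().[x]
  = (\prod_(z <- s) ('X - z%:P)).[x] * \sum_(z <- s) (x - z)^-1.
Proof.
elim: s => [|y s IH]; first by rewrite !big_nil derivC horner0 mulr0.
rewrite inE negb_or => /andP[xy /IH {}IH].
rewrite !big_cons derivM derivXsubC mul1r.
rewrite hornerD !hornerM IH hornerXsubC; field.
by rewrite subr_eq0.
Qed.

Section AverageFromZeros.

Variables (R : realType) (G : sgraph).
Local Notation C := R[i].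
Local Notation n := (order_of G).
Local Notation ii := ('i%C : C).
Local Notation total := (\sum_(k < n./2.+1) (nmatch G k)%:R : R).

Lemma total_matchings_gt0 : 0 < total.
Proof.
rewrite big_ord_recl nmatch0 ltr_pwDl ?ltr01 // sumr_ge0 // => k _.
Qed.

(** Since i^2 = -1, the alternating signs of the matching polynomial cancel at i, leaving the common
    phase i^n. *)
Lemma expi_sub_double (k : nat) : (k.*2 <= n)%N ->
  (-1) ^+ k * ii ^+ (n - k.*2) = ii ^+ n.
Proof.
move=> le2k; rewrite -[in RHS](subnK le2k) exprD -mul2n exprM sqr_i.
by rewrite mulrC.
Qed.

Lemma ord_double_leq (k : 'I_n./2.+1) : (k.*2 <= n)%N.
Proof. by rewrite -geq_half_double -ltnS. Qed.

Lemma matching_poly_at_i :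
  (matching_poly C G).[ii] = ii ^+ n * total%:C%C.
Proof.
rewrite horner_sum rmorph_sum mulr_sumr; apply: eq_bigr => k _.
rewrite hornerZ hornerXn -mulrA expi_sub_double ?ord_double_leq // mulrC.
by rewrite rmorph_nat.
Qed.

(** The factor [ii] restores the power lost by differentiation, so the phase is again i^n. *)
Lemma deriv_matching_poly_at_i :
  ii * (matching_poly C G)^`().[ii]
  = ii ^+ n * (\sum_(k < n./2.+1) (n - k.*2)%:R * (nmatch G k)%:R : R)%:C%C.
Proof.
rewrite raddf_sum horner_sum rmorph_sum !mulr_sumr; apply: eq_bigr => k _ /=.
rewrite derivZ derivXn hornerZ hornerMn hornerXn rmorphM !rmorph_nat.
rewrite -(expi_sub_double (ord_double_leq k)).
(* For n = 2k the exponent cannot drop by one, but the factor n - 2k kills both sides. *)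
case: (n - k.*2)%N => [|m]; first by rewrite mulr0n !mul0r !mulr0.
by rewrite -pred_Sn exprS -mulr_natr; ring.
Qed.

Lemma matching_poly_zeros :
  matching_poly C G = lead_coef (matching_poly C G) *:
    \prod_(z <- matching_zeros R G) ('X - z%:P).
Proof. exact: svalP (closed_field_poly_normal (matching_poly C G)). Qed.

Lemma lead_coef_matching_poly_neq0 : lead_coef (matching_poly C G) != 0.
Proof. by rewrite lead_coef_eq0 -size_poly_eq0 size_matching_poly. Qed.

Lemma size_matching_zeros : size (matching_zeros R G) = n.
Proof.
apply: succn_inj; rewrite -(size_matching_poly C G) matching_poly_zeros.
by rewrite size_scale ?lead_coef_matching_poly_neq0 // size_prod_XsubC.
Qed.

Lemma root_matching_zeros (z : C) :
  z \in matching_zeros R G -> root (matching_poly C G) z.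
Proof.
move=> zs; rewrite matching_poly_zeros rootZ ?lead_coef_matching_poly_neq0 //.
by rewrite root_prod_XsubC.
Qed.

Lemma matching_zeros_logderiv :
  ii * (\sum_(z <- matching_zeros R G) (ii - z)^-1) * total%:C%C
  = (\sum_(k < n./2.+1) (n - k.*2)%:R * (nmatch G k)%:R : R)%:C%C.
Proof.
have ii0 : ii ^+ n != 0 by rewrite expf_neq0 // neq0Ci.
apply: (mulfI ii0); rewrite -deriv_matching_poly_at_i.
(* The zeros are real and Im i = 1, so i is not among them. *)
rewrite matching_poly_zeros derivZ hornerZ logderiv_prod_XsubC; last first.
  apply/negP => /root_matching_zeros/root_matching_poly_real/eqP.
  by rewrite oner_eq0.
rewrite [lead_coef _ * _]mulrA -hornerZ -matching_poly_zeros matching_poly_at_i.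
ring.
Qed.

(** Take real parts in [matching_zeros_logderiv]: for real a, i / (i - a) = (1 - i a) / (1 +
    a^2). *)
Lemma sum_inv_matching_zeros :
  (\sum_(z <- matching_zeros R G) (1 + complex.Re z ^+ 2)^-1) * total
  = \sum_(k < n./2.+1) (n - k.*2)%:R * (nmatch G k)%:R.
Proof.
rewrite -[RHS]/(complex.Re (_%:C)%C) -matching_zeros_logderiv [ii * _]mulr_sumr.
have ReMr (x : C) (r : R) : complex.Re (x * r%:C%C) = complex.Re x * r.
  by case: x => a b /=; rewrite mulr0 subr0.
rewrite ReMr (big_morph _ (@ReD R) (erefl : complex.Re (0 : C) = 0)).
congr (_ * _).
apply: eq_big_seq => z /root_matching_zeros/root_matching_poly_real.
case: z => a b /= ->.
rewrite !mul0r !mul1r !sub0r subr0 opprK sqrrN expr1n addrC.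
by rewrite mul1r.
Qed.

Lemma av_matching_zeros :
  2 * av R G = \sum_(z <- matching_zeros R G)
                  complex.Re z ^+ 2 / (1 + complex.Re z ^+ 2).
Proof.
have T0 : total != 0 by rewrite gt_eqF ?total_matchings_gt0.
have -> : \sum_(z <- matching_zeros R G)
      complex.Re z ^+ 2 / (1 + complex.Re z ^+ 2)
    = n%:R - \sum_(z <- matching_zeros R G) (1 + complex.Re z ^+ 2)^-1.
  (* There are n zeros with multiplicity, so n is spread as one 1 per zero. *)
  rewrite -size_matching_zeros -sum1_size natr_sum -sumrB; apply: eq_bigr => z _.
  field.
  by rewrite gt_eqF // ltr_pwDl ?ltr01 ?sqr_ge0.
apply: (mulIf T0); rewrite mulrBl sum_inv_matching_zeros /av mulrA divfK //.
rewrite !mulr_sumr -sumrB; apply: eq_bigr => k _.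
by rewrite natrB ?ord_double_leq // -mul2n natrM; ring.
Qed.

End AverageFromZeros.

Theorem theorem5p4 (R : realType) (G : sgraph) :
  matching_energy R G >= 4 * av R G.
Proof.
have -> : 4 * av R G = 2 * (2 * av R G) by ring.
rewrite av_matching_zeros mulr_sumr /matching_energy !big_seq.
apply: ler_sum => z /root_matching_zeros/root_matching_poly_real.
case: z => a b /= ->; rewrite expr0n addr0 sqrtr_sqr.
have p : 0 < 1 + a ^+ 2 by rewrite ltr_pwDl ?ltr01 ?sqr_ge0.
rewrite mulrA ler_pdivrMr // -(real_normK (num_real a)).
(* With x = |a|, the claim 2 x^2 <= x (1 + x^2) is exactly x (1 - x)^2 >= 0. *)
have := mulr_ge0 (normr_ge0 a) (sqr_ge0 (1 - `|a|)).
set x := `|a|; nra.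
Qed.
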